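(* Let $\mathbb X$ be a Euclidean space, let $f\colon\mathbb X\to\mathbb R$ be continuously differentiable, let $\phi\colon\mathbb X\to\mathbb R\cup\{\infty\}$ be lower semicontinuous with $\operatorname{dom}\phi\neq\emptyset$, and set $\psi:=f+\phi$. Assume that $\psi$ is bounded from below on $\operatorname{dom}\phi$, that $\phi$ is bounded from below by an affine function, and that $\nabla f\colon\mathbb X\to\mathbb X$ is locally Lipschitz continuous. Let $\{x^k\}$ be any (infinite) sequence generated by the Proximal Gradient Method (described in the context) applied to $\min_{x\in\mathbb X}\psi(x)$. Suppose that $\{x^k\}_K$ is a subsequence of $\{x^k\}$ converging to some limit point $x^*\in\mathbb X$, and that $\psi$ has the KL property at $x^*$. Then the entire sequence $\{x^k\}$ converges to $x^*$.
   Context: A Euclidean space is a real finite-dimensional Hilbert space, with inner product $\langle\cdot,\cdot\rangle$ and associated norm $\|\cdot\|$. For $\vartheta\colon\mathbb X\to\mathbb R\cup\{\infty\}$, $\operatorname{dom}\vartheta:=\{x\in\mathbb X\mid\vartheta(x)<\infty\}$. For a set $A\subset\mathbb X$, $\operatorname{dist}(x,A):=\inf\{\|y-x\|\mid y\in A\}$, with $\operatorname{dist}(x,\emptyset):=\infty$. Proximal Gradient Method. Parameters: $\tau>1$, $0<\gamma_{\min}\le\gamma_{\max}<\infty$, $\delta\in(0,1)$, starting point $x^0\in\operatorname{dom}\phi$. In each iteration $k=0,1,2,\ldots$: choose $\gamma_k^0\in[\gamma_{\min},\gamma_{\max}]$; for $i=0,1,2,\ldots$, set $\gamma_{k,i}:=\tau^i\gamma_k^0$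 and compute a (global) solution $x^{k,i}$ of $$\min_{x\in\mathbb X}\ f(x^k)+\langle\nabla f(x^k),x-x^k\rangle+\frac{\gamma_{k,i}}{2}\|x-x^k\|^2+\phi(x),$$ until the acceptance criterion $$\psi(x^{k,i})\le\psi(x^k)-\delta\frac{\gamma_{k,i}}{2}\|x^{k,i}-x^k\|^2$$ holds for the first time; let $i_k:=i$ be this terminal index, and set $\gamma_k:=\gamma_{k,i_k}$ and $x^{k+1}:=x^{k,i_k}$. It is assumed throughout that the method generates an infinite sequence (the inner loops all terminate and no outer termination criterion stops the method). Subdifferentials. For lower semicontinuous $\vartheta\colon\mathbb X\to\mathbb R\cup\{\infty\}$ and $x\in\operatorname{dom}\vartheta$, the regular subdifferential is $$\widehat\partial\vartheta(x):=\Big\{\eta\in\mathbb X\ \Big|\ \liminf_{y\to x,\,y\ne x}\frac{\vartheta(y)-\vartheta(x)-\langle\eta,y-x\rangle}{\|y-x\|}\ge0\Big\},$$ and the limiting (Mordukhovich) subdifferential $\partial\vartheta(x)$ is the set of all $\eta\in\mathbb X$ for which there exist sequences $x^k\to x$ and $\eta^k\to\eta$ with $\vartheta(x^k)\to\vartheta(x)$ and $\eta^k\in\widehat\partial\vartheta(x^k)$ for all $k$. For $x\notin\operatorname{dom}\vartheta$ these sets are empty. KL property. A lower semicontinuous $g\colon\mathbb X\to\mathbb R\cup\{\infty\}$ has the KL (Kurdyka–Łojasiewicz) property at a point $x^*$ with $\partial g(x^* )\ne\emptyset$ if there exist a constant $\eta>0$, a neighborhood $U\subset\mathbb X$ of $x^*$,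 and a continuous concave function $\chi\colon[0,\eta]\to[0,\infty)$, continuously differentiable on $(0,\eta)$, with $\chi(0)=0$ and $\chi'(t)>0$ for all $t\in(0,\eta)$, such that $$\chi'\big(g(x)-g(x^* )\big)\operatorname{dist}\big(0,\partial g(x)\big)\ge1$$ holds for all $x\in U\cap\{x\in\mathbb X\mid g(x^* )<g(x)<g(x^* )+\eta\}$. The function $\chi$ is called the desingularization function. *)

(* Defs.v *)
From HB Require Import structures.
From mathcomp Require Import all_boot all_order all_algebra.
From mathcomp Require Import sesquilinear.
From mathcomp Require Import all_classical all_reals all_analysis.

Set Implicit Arguments.
Unset Strict Implicit.
Unset Printing Implicit Defensive.

Import Order.TTheory GRing.Theory Num.Theory.
Import numFieldNormedType.Exports.

Local Open Scope classical_set_scope.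
Local Open Scope ring_scope.

(* [Vector] provides finite dimension; for the form [{dot X for idfun}]
   positive definiteness, symmetry and bilinearity are part of the type. *)
HB.mixin Record NormedModule_isEuclidean (R : realType) X
    of NormedModule R X & Vector R X := {
  inner : {dot X for (idfun : R -> R)} ;
  sqr_norm_inner : forall x : X, `|x| ^+ 2 = inner x x }.

#[short(type="euclideanType")]
HB.structure Definition Euclidean (R : realType) :=
  {X of NormedModule_isEuclidean R X & NormedModule R X & Vector R X}.

Section Defs.
Context {R : realType} {X : euclideanType R}.
Implicit Types (f : X -> R) (phi theta : X -> \bar R) (x : X).

Definition dom theta : set X := [set x | (theta x < +oo)%E].

(* By the Riesz representation theorem every differentiable [f] has exactly
   one gradient. *)
Definition is_gradient f (gradf : X -> X) :=
  forall x, differentiable f x /\ forall v, 'd f x v = inner (gradf x) v.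

Definition C1_with_gradient f (gradf : X -> X) :=
  is_gradient f gradf /\ continuous gradf.

Definition locally_lipschitz (F : X -> X) :=
  forall x, exists2 U, nbhs x U & [lipschitz F y | y in U].

(* [ereal_inf set0 = +oo], hence [dist x set0 = +oo]. *)
Definition dist x (A : set X) : \bar R :=
  ereal_inf [set (`|y - x|)%:E | y in A].

Definition regular_subdiff theta x : set X :=
  [set eta | dom theta x /\
    (0 <= limf_einf (fun y =>
       (theta y - theta x - (inner eta (y - x))%:E) * (`|y - x|^-1)%:E)
       x^')%E].

Definition limiting_subdiff theta x : set X :=
  [set eta | dom theta x /\
    exists (u e : nat -> X),
      [/\ u n @[n --> \oo] --> x,
          e n @[n --> \oo] --> eta,
          theta (u n) @[n --> \oo] --> theta x
        & forall n, regular_subdiff theta (u n) (e n)]].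

(* [chi] is a total function, but only its values on [0, eta] matter. *)
Record desingularization (eta : R) (chi : R -> R) : Prop := {
  desing_ge0 : {in `[0, eta], forall t, 0 <= chi t} ;
  desing_cont : {within `[0, eta], continuous chi} ;
  desing_concave :
    convex_function (E := R^o) `[0, eta]%classic (fun t => - chi t) ;
  desing_derivable : {in `]0, eta[, forall t, derivable chi t 1} ;
  desing_cont_derive : {in `]0, eta[, continuous (derive1 chi)} ;
  desing_at0 : chi 0 = 0 ;
  desing_derive_gt0 : {in `]0, eta[, forall t, 0 < derive1 chi t} }.

(* [g x - g xs] is a real number wherever [fine] is used: [g xs] is finite
   because its subdifferential is nonempty, and [g x < g xs + eta]. *)
Definition KL_property (g : X -> \bar R) (xs : X) :=
  limiting_subdiff g xs !=set0 /\
  exists (eta : R) (chi : R -> R),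
    [/\ 0 < eta, desingularization eta chi &
      \forall x \near xs, (g xs < g x < g xs + eta%:E)%E ->
        (1 <= (derive1 chi (fine (g x - g xs)))%:E
              * dist 0%R (limiting_subdiff g x))%E].

Definition objective f phi : X -> \bar R := fun x => ((f x)%:E + phi x)%E.

Definition prox_model f (gradf : X -> X) phi (xk : X) (gamma : R) :
    X -> \bar R := fun x =>
  ((f xk + inner (gradf xk) (x - xk) + gamma / 2 * `|x - xk| ^+ 2)%:E
   + phi x)%E.

Definition global_min (q : X -> \bar R) x := forall y, (q x <= q y)%E.

Definition accepted f phi (delta : R) (xk : X) (gamma : R) x :=
  (objective f phi x
   <= objective f phi xk - (delta * (gamma / 2) * `|x - xk| ^+ 2)%:E)%E.

(* [x k] are the iterates, [gamma0 k] the initial stepsizes, [trial k i] the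
   inner iterates and [last k] the terminal inner index; [trial k i] is
   unconstrained for [i > last k], where the method computes nothing. *)
Record PGM_run f (gradf : X -> X) phi (tau gmin gmax delta : R)
    (x : nat -> X) (gamma0 : nat -> R) (trial : nat -> nat -> X)
    (last : nat -> nat) : Prop := {
  PGM_start : dom phi (x 0%N) ;
  PGM_stepsize : forall k, gmin <= gamma0 k <= gmax ;
  PGM_trial : forall k i, (i <= last k)%N ->
    global_min (prox_model f gradf phi (x k) (tau ^+ i * gamma0 k))
               (trial k i) ;
  PGM_reject : forall k i, (i < last k)%N ->
    ~ accepted f phi delta (x k) (tau ^+ i * gamma0 k) (trial k i) ;
  PGM_accept : forall k,
    accepted f phi delta (x k) (tau ^+ last k * gamma0 k) (trial k (last k)) ;
  PGM_next : forall k, x k.+1 = trial k (last k) }.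

Definition PGM_sequence f (gradf : X -> X) phi (tau gmin gmax delta : R)
    (x : nat -> X) :=
  exists (gamma0 : nat -> R) (trial : nat -> nat -> X) (last : nat -> nat),
    PGM_run f gradf phi tau gmin gmax delta x gamma0 trial last.

End Defs.

(* Main.v *)
Require Import Defs.
From HB Require Import structures.
From mathcomp Require Import all_boot all_order all_algebra.
From mathcomp Require Import all_classical all_reals all_analysis.
From mathcomp Require Import sesquilinear ring lra.

Set Implicit Arguments.
Unset Strict Implicit.
Unset Printing Implicit Defensive.

Import Order.TTheory GRing.Theory Num.Theory.
Import numFieldNormedType.Exports.

Local Open Scope classical_set_scope.
Local Open Scope ring_scope.

(** Write psi for the objective f + phi, d_n for the step length
    |x_(n+1) - x_n| and Delta_n for the gap psi(x_n) - psi(xs).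

    The gradient of f is Lipschitz only near xs, so nothing is known about a
    step that starts or ends far away.  What saves the method is that a trial
    step with a large parameter gamma is short, because phi has an affine
    minorant; started close to xs, such a step stays in the ball where the
    descent inequality for f is valid, and is accepted
    ([large_step_accepted]).  Hence backtracking keeps gamma_n below a bound
    Gamma as long as x_n is close to xs ([run_stepsize_bounded]).  This has two
    consequences.  Comparing x_(n+1) with xs in the minimized model, for x_n
    close to xs, gives Delta_n -> 0 ([run_value_cvg]).  And the optimality
    condition of the model yields a subgradient of psi at x_(n+1) of norm at
    most (L + Gamma) d_n ([prox_min_regular_subdiff]).

    Combined with the concavity of chi and with sufficient decrease, the KL
    inequality at x_(n+1) then reads
      2 d_(n+1) <= d_n + K (chi(Delta_(n+1)) - chi(Delta_(n+2))),
    valid while x_n and x_(n+1) are close to xs ([run_KL_step]).  It says that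
      V_n = |x_(n+1) - xs| + d_n + K chi(Delta_(n+1))
    does not increase.  As V_n dominates |x_(n+1) - xs|, a small value of V
    confines the rest of the sequence to the ball in which V is known to be
    nonincreasing, so V stays small for ever.  Along the convergent subsequence
    V takes arbitrarily small values, and the whole sequence converges
    ([lyapunov_cvg]). *)

(** * Inner product, mean value and proximal subgradients *)

Section Euclid.
Context {R : realType} {X : euclideanType R}.
Implicit Types u v w : X.

Lemma innerC u v : inner u v = inner v u.
Proof. by rewrite hermC /= expr0 mul1r. Qed.

(** The Cauchy-Schwarz inequality comes for free from the triangle inequality
    of the norm, squared. *)
Lemma inner_le_norm u v : inner u v <= `|u| * `|v|.
Proof.
have : `|u + v| ^+ 2 <= (`|u| + `|v|) ^+ 2.
  by rewrite lerXn2r ?nnegrE ?addr_ge0 ?ler_normD.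
rewrite sqrrD !sqr_norm_inner linearDl !linearDr /= (innerC v u).
lra.
Qed.

Lemma norm_inner_le u v : `|inner u v| <= `|u| * `|v|.
Proof.
rewrite ler_norml inner_le_norm andbT lerNl -linearNr /=.
by rewrite (le_trans (inner_le_norm _ _)) ?normrN.
Qed.

Lemma sqr_normD u v : `|u + v| ^+ 2 = `|u| ^+ 2 + 2 * inner u v + `|v| ^+ 2.
Proof. by rewrite !sqr_norm_inner linearDl !linearDr /= (innerC v u); ring. Qed.

Lemma gradient_mean_value (f : X -> R) (g : X -> X) u v :
  is_gradient f g ->
  exists2 t, t \in `[0, 1] &
    f v - f u = inner (g (u + t *: (v - u))) (v - u).
Proof.
move=> fg; pose h (t : R) : R := f (u + t *: (v - u)).
have dh (t : R) : is_derive t 1 h (inner (g (u + t *: (v - u))) (v - u)).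
  have dl : is_diff t (fun s : R => u + s *: (v - u))
      (fun s : R => s *: (v - u)).
    apply: (@is_diff_eq _ _ _ (cst u + *:%R^~ (v - u))).
    by apply/funext => s; exact: add0r.
  have [df dfE] := fg (u + t *: (v - u)).
  have dfl := differentiableP df.
  have dhd := is_diff_comp dl dfl.
  have hdiff : differentiable h t by exact: (@ex_diff _ _ _ _ _ _ _ dhd).
  apply: DeriveDef; first exact/derivable1_diffP.
  rewrite deriveE // (@diff_val _ _ _ _ _ _ _ dhd) /=.
  by rewrite scale1r dfE.
have [t t01 ht] : exists2 t, t \in `[0, 1] & h 1 - h 0 =
    inner (g (u + t *: (v - u))) (v - u) * (1 - 0).
  apply: (@MVT_segment R h
    (fun t => inner (g (u + t *: (v - u))) (v - u))) => //.
  apply: continuous_subspaceT => t.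
  by apply/differentiable_continuous/derivable1_diffP.
exists t => //; rewrite subr0 mulr1 in ht; rewrite -ht /h.
by rewrite scale1r scale0r addr0 subrKC.
Qed.

Lemma ball_segment (c : X) r u v (t : R) : ball c r u -> ball c r v ->
  t \in `[0, 1] -> ball c r (u + t *: (v - u)).
Proof.
rewrite -!ball_normE /= => cu cv; rewrite in_itv /= => /andP[t0 t1].
have -> : c - (u + t *: (v - u)) = (1 - t) *: (c - u) + t *: (c - v).
  rewrite scalerBl scale1r -addrA [- _ + _]addrC -scalerBr.
  have -> : c - v - (c - u) = - (v - u).
    by rewrite !opprB [u - c]addrC addrACA subrr add0r addrC.
  by rewrite scalerN opprD addrA.
have [->|t_neq0] := eqVneq t 0.
  by rewrite subr0 scale0r scale1r addr0.
apply: (le_lt_trans (ler_normD _ _)).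
rewrite !normrZ (ger0_norm t0) ger0_norm ?subr_ge0//.
have -> : r = (1 - t) * r + t * r by ring.
apply: ler_ltD; first by apply: ler_wpM2l; [lra|exact: ltW].
by rewrite ltr_pM2l// lt_def t_neq0.
Qed.

(** A mean value point lies on the segment, hence in the ball, at distance at
    most |v - u| from u. *)
Lemma gradient_quadratic_bound (f : X -> R) (g : X -> X) (c : X) r L u v :
  is_gradient f g -> 0 <= L ->
  (forall y z, ball c r y -> ball c r z -> `|g y - g z| <= L * `|y - z|) ->
  ball c r u -> ball c r v ->
  `|f v - f u - inner (g u) (v - u)| <= L * `|v - u| ^+ 2.
Proof.
move=> fg L0 lip cu cv; have [t t01 ->] := gradient_mean_value u v fg.
rewrite -linearBl /=; apply: (le_trans (norm_inner_le _ _)).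
rewrite expr2 mulrA ler_wpM2r//.
apply: (le_trans (lip _ _ (ball_segment cu cv t01) cu)).
rewrite [u + _]addrC addrK normrZ ler_wpM2l//.
move: t01; rewrite in_itv /= => /andP[t0 t1].
by rewrite ger0_norm// ler_piMl.
Qed.

(** Proximal subgradients are regular: the quadratic error, divided by
    |y - z|, still tends to 0. *)
Lemma quadratic_minorant_regular_subdiff (theta : X -> \bar R) z eta C :
  theta z \is a fin_num ->
  (\forall y \near z,
    theta z + (inner eta (y - z) - C * `|y - z| ^+ 2)%:E <= theta y)%E ->
  regular_subdiff theta z eta.
Proof.
move=> tz low; split; first by rewrite /dom /= ltey_eq tz.
rewrite limf_einfE; apply/lee_addgt0Pr => e e0.
rewrite -leeBlDr// sub0e.
have small : \forall y \near z, C * `|y - z| <= e.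
  have k0 : 0 < e / (`|C| + 1) by rewrite divr_gt0// ltr_wpDl.
  apply: filterS (nbhsx_ballx z _ k0) => y; rewrite -ball_normE /= distrC.
  rewrite ltr_pdivlMr ?ltr_wpDl// => /ltW; apply: le_trans.
  rewrite mulrC ler_wpM2l// (le_trans (ler_norm C))// lerDl//.
apply: le_ereal_sup_tmp.
exists (ereal_inf ((fun y => (theta y - theta z - (inner eta (y - z))%:E) *
    (`|y - z|^-1)%:E)%E @` [set y | y != z /\
  (theta z + (inner eta (y - z) - C * `|y - z| ^+ 2)%:E <= theta y)%E /\
   C * `|y - z| <= e])).
  eexists; last reflexivity.
  rewrite /dnbhs /within /=; near=> y => yz; split => //; split; near: y => //.
apply: le_ereal_inf_tmp => _ [y [yz [lowy smally]] <-].
have d0 : 0 < `|y - z| by rewrite normr_gt0 subr_eq0.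
rewrite -(fineK tz) in lowy *.
case: (theta y) lowy => [t|_|//].
  rewrite -!EFinD -!EFinM !lee_fin => lowy.
  rewrite ler_pdivlMr//.
  have : C * `|y - z| * `|y - z| <= e * `|y - z| by rewrite ler_wpM2r.
  lra.
by rewrite !addye// gt0_mulye ?lte_fin ?invr_gt0// leey.
Unshelve. all: by end_near. Qed.
End Euclid.

(** * Desingularization functions *)

Section Desing.
Context {R : realType}.
Implicit Types (eta s t : R) (chi : R -> R).

(** The graph of a concave function lies below its tangents.  The derivative
    is bounded by the slope of the chord over [s, t] because the difference
    quotients from the left are. *)
Lemma desingularization_tangent eta chi s t :
  desingularization eta chi -> 0 <= s -> s <= t -> 0 < t -> t < eta ->
  derive1 chi t * (t - s) <= chi t - chi s.
Proof.
move=> dchi s0 + t0 teta; rewrite le_eqVlt => /predU1P[->|st].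
  by rewrite !subrr mulr0.
rewrite -ler_pdivlMr ?subr_gt0//.
have dt : derivable chi t 1.
  by apply: (desing_derivable dchi); rewrite in_itv/= t0.
have slopes : (fun h : R => h^-1 *: (chi (h *: 1 + t) - chi t)) @ (0 : R)^'-
    --> derive1 chi t.
  rewrite derive1E; apply: cvg_trans dt.
  by apply: cvg_app; apply: within_subset => h /= h0; rewrite lt_eqF.
apply: (cvgr_to_le slopes).
near=> h.
have h0 : h < 0 by near: h; apply: nbhs_left_lt.
have hst : s - t < h by near: h; apply: nbhs_left_gt; rewrite subr_lt0.
rewrite /= scaler1 -[_ *: _]/(h^-1 * _).
(* [h + t] is the convex combination of [t] and [s] with weight
   [1 + h / (t - s)] on [t] *)
have l0 : 0 <= 1 + h / (t - s).
  by rewrite -lerBlDl sub0r ler_pdivlMr ?subr_gt0//; lra.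
have l1 : 1 + h / (t - s) <= 1.
  by rewrite gerDl pmulr_lle0 ?invr_gt0 ?subr_gt0// ltW.
have s_in : (s : convex_lmodType R^o) \in (`[0, eta]%classic : set R).
  by rewrite inE /= in_itv /= s0 ltW// (lt_trans st).
have t_in : (t : convex_lmodType R^o) \in (`[0, eta]%classic : set R).
  by rewrite inE /= in_itv /= !ltW.
pose l := 1 + h / (t - s).
have conc : - chi (l * t + (1 - l) * s) <= l * - chi t + (1 - l) * - chi s.
  exact: desing_concave dchi (Itv01 l0 l1) _ _ t_in s_in.
have lE : l * t + (1 - l) * s = h + t.
  by rewrite /l; field; rewrite subr_eq0 gt_eqF.
rewrite lE /l in conc.
rewrite -(ler_nM2l h0) mulVKf ?lt_eqF//.
have : (chi t - chi s) * (h / (t - s)) <= chi (h + t) - chi t by lra.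
apply: le_trans; rewrite le_eqVlt; apply/orP; left; apply/eqP.
by field; rewrite subr_eq0 gt_eqF.
Unshelve. all: by end_near. Qed.

Lemma desingularization_small eta chi e : 0 < eta ->
  desingularization eta chi -> 0 < e ->
  exists2 d, 0 < d & forall t, 0 <= t -> t < d -> chi t < e.
Proof.
move=> eta0 dchi e0.
have /(continuous_within_itvP _ eta0)[_ /cvgr_lt + _] := desing_cont dchi.
rewrite (desing_at0 dchi).
move=> /(_ e e0) /nbhs_right0P /nbhs_ballP[d /= d0 small].
exists d => // t; rewrite le_eqVlt => /predU1P[<-|t0] td.
  by rewrite (desing_at0 dchi).
rewrite -[t]add0r; apply: small => //=.
by rewrite -ball_normE /= sub0r normrN gtr0_norm.
Qed.
End Desing.

(** * Minimizers of the proximal model *)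

Section Prox.
Context {R : realType} {X : euclideanType R}.
Context (f : X -> R) (g : X -> X) (phi : X -> \bar R).
Context (phi_ninfty : forall y, phi y != -oo%E).
Implicit Types (x y z : X) (gamma delta : R).

Lemma locally_lipschitz_ball xs : locally_lipschitz g ->
  exists r L, [/\ 0 < r, 0 <= L & forall y z, ball xs r y -> ball xs r z ->
    `|g y - g z| <= L * `|y - z|].
Proof.
move=> /(_ xs)[U /nbhs_ballP[r /= r0 rU] [M [_ lipM]]].
pose L := Num.max 0 (M + 1).
have ML : M < L by rewrite /L lt_max ltrDl ltr01 orbT.
exists r, L; split=> [//||y z /rU Uy /rU Uz]; first by rewrite le_max lexx.
exact: (lipM L ML (y, z)).
Qed.

Lemma prox_min_fin_num x gamma z : phi x \is a fin_num ->
  global_min (prox_model f g phi x gamma) z -> phi z \is a fin_num.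
Proof.
move=> /fineK px /(_ x); rewrite /prox_model -px.
by have := phi_ninfty z; case: (phi z).
Qed.

Lemma prox_min_le x gamma z y : phi z \is a fin_num -> phi y \is a fin_num ->
  global_min (prox_model f g phi x gamma) z ->
  inner (g x) (z - x) + gamma / 2 * `|z - x| ^+ 2 + fine (phi z) <=
  inner (g x) (y - x) + gamma / 2 * `|y - x| ^+ 2 + fine (phi y).
Proof.
move=> /fineK pz /fineK py /(_ y).
rewrite /prox_model -pz -py /= -!EFinD lee_fin.
lra.
Qed.

Lemma prox_min_self_le x gamma z : phi z \is a fin_num -> phi x \is a fin_num ->
  global_min (prox_model f g phi x gamma) z ->
  inner (g x) (z - x) + gamma / 2 * `|z - x| ^+ 2 + fine (phi z) <=
  fine (phi x).
Proof.
move=> pz px /(prox_min_le pz px).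
by rewrite [x - x]subrr linear0 normr0 expr0n mulr0 !add0r.
Qed.

(** Minimality of z compared with x controls phi, the quadratic bound controls
    f: together psi drops by at least (gamma / 2 - L) |z - x|^2. *)
Lemma prox_min_accepted c r L x gamma z delta :
  is_gradient f g -> 0 <= L ->
  (forall y z, ball c r y -> ball c r z -> `|g y - g z| <= L * `|y - z|) ->
  ball c r x -> ball c r z -> 2 * L <= (1 - delta) * gamma ->
  phi x \is a fin_num ->
  global_min (prox_model f g phi x gamma) z ->
  accepted f phi delta x gamma z.
Proof.
move=> fg L0 lip cx cz Lg px zmin; have pz := prox_min_fin_num px zmin.
have := prox_min_self_le pz px zmin.
have := gradient_quadratic_bound fg L0 lip cx cz.
rewrite /accepted /objective -(fineK px) -(fineK pz) -!EFinD lee_fin.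
rewrite ler_norml => /andP[_].
have : 2 * L * `|z - x| ^+ 2 <= (1 - delta) * gamma * `|z - x| ^+ 2.
  by rewrite ler_wpM2r ?sqr_ge0.
lra.
Qed.

(** Minimality and the affine minorant give
    gamma / 2 |z - x|^2 <= A + B |z - x|, which a step of length at least rho
    violates as soon as gamma is large. *)
Lemma prox_min_close x gamma z (a : X) b A B rho :
  (forall y, ((inner a y + b)%:E <= phi y)%E) ->
  phi x \is a fin_num -> global_min (prox_model f g phi x gamma) z ->
  0 < rho -> 0 <= A -> 0 <= B ->
  fine (phi x) - inner a x - b <= A -> `|g x| + `|a| <= B ->
  2 * (A / rho ^+ 2 + B / rho) < gamma -> `|z - x| < rho.
Proof.
move=> aff px zmin rho0 A0 B0 leA leB gam; rewrite ltNge; apply/negP => far.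
have pz := prox_min_fin_num px zmin.
have self := prox_min_self_le pz px zmin.
have affz : inner a z + b <= fine (phi z) by rewrite -lee_fin fineK.
have az : inner a z = inner a x + inner a (z - x) by rewrite linearB /=; ring.
have gd : - (`|g x| * `|z - x|) <= inner (g x) (z - x).
  by have := norm_inner_le (g x) (z - x); rewrite ler_norml => /andP[].
have ad : - (`|a| * `|z - x|) <= inner a (z - x).
  by have := norm_inner_le a (z - x); rewrite ler_norml => /andP[].
have Bd : (`|g x| + `|a|) * `|z - x| <= B * `|z - x| by rewrite ler_wpM2r.
have t1 : 1 <= `|z - x| / rho by rewrite ler_pdivlMr// mul1r.
have d0 : 0 < `|z - x| by apply: lt_le_trans far.
(* homogenize: multiply [A] by [(|z - x| / rho)^2] and [B] by
   [|z - x| / rho], both factors being at least 1 *)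
have ABd : A + B * `|z - x| <= (A / rho ^+ 2 + B / rho) * `|z - x| ^+ 2.
  have -> : (A / rho ^+ 2 + B / rho) * `|z - x| ^+ 2 =
      A * (`|z - x| / rho) ^+ 2 + B * `|z - x| * (`|z - x| / rho).
    by field; rewrite gt_eqF.
  apply: lerD; first by rewrite ler_peMr// expr_ge1// (le_trans ler01).
  by rewrite ler_peMr// mulr_ge0.
have := ltr_pM2r (exprn_gt0 2 d0) (2 * (A / rho ^+ 2 + B / rho)) gamma.
rewrite gam; move: ABd; set q := A / _ + _; move=> ABd big.
lra.
Qed.

(** Fermat's rule for the model: the optimality inequality, with the model of f
    replaced by f itself up to a quadratic error, is a quadratic minorant of
    psi at z. *)
Lemma prox_min_regular_subdiff c r L x gamma z :
  is_gradient f g -> 0 <= L ->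
  (forall y z, ball c r y -> ball c r z -> `|g y - g z| <= L * `|y - z|) ->
  ball c r z -> phi z \is a fin_num ->
  global_min (prox_model f g phi x gamma) z ->
  regular_subdiff (objective f phi) z (g z - g x - gamma *: (z - x)).
Proof.
move=> fg L0 lip cz pz zmin.
apply: (@quadratic_minorant_regular_subdiff _ _ _ _ _ (L + gamma / 2)).
  by rewrite /objective fin_numD pz.
have : \forall y \near z, ball c r y.
  by move: (ball_open c r); rewrite openE; exact.
apply: filterS => y cy.
rewrite /objective.
have [py|] := boolP (phi y \is a fin_num); last first.
  by rewrite fin_numE phi_ninfty /= negbK => /eqP ->; rewrite addey// leey.
have := prox_min_le pz py zmin.
rewrite -(fineK pz) -(fineK py) -!EFinD lee_fin.
have := gradient_quadratic_bound fg L0 lip cz cy.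
rewrite ler_norml => /andP[+ _].
have -> : y - x = (z - x) + (y - z) by rewrite [RHS]addrC subrKA.
(* everything is linear in the inner products with [w = z - x], [d = y - z] *)
move: (y - z) (z - x) => d w quad opt.
have e1 := sqr_normD w d.
have e2 : inner (g x) (w + d) = inner (g x) w + inner (g x) d.
  by rewrite linearDr.
have e3 : inner (g z - g x - gamma *: w) d =
    inner (g z) d - inner (g x) d - gamma * inner w d.
  by rewrite !linearBl /= linearZl_LR.
rewrite e1 e2 in opt; rewrite e3.
lra.
Qed.

Lemma regular_limiting_subdiff (theta : X -> \bar R) z :
  regular_subdiff theta z `<=` limiting_subdiff theta z.
Proof.
move=> e ez; split; first by case: ez.
by exists (fun=> z), (fun=> e); split => //; exact: cvg_cst.
Qed.

End Prox.

(** * Proximal steps near a given point *)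

Section Local.
Context {R : realType} {X : euclideanType R}.
Context (f : X -> R) (g : X -> X) (phi : X -> \bar R).
Context (phi_ninfty : forall y, phi y != -oo%E).
Implicit Types (x y z : X) (gamma delta : R).

(** The bound M on psi(x) bounds phi(x) from above near xs, which makes the
    constants A and B of [prox_min_close] uniform in x. *)
Lemma large_step_accepted xs M delta : C1_with_gradient f g ->
  locally_lipschitz g ->
  (exists (a : X) (b : R), forall y, ((inner a y + b)%:E <= phi y)%E) ->
  delta < 1 ->
  exists r Gamma, 0 < r /\ forall x z gamma, ball xs r x ->
    phi x \is a fin_num -> (objective f phi x <= M%:E)%E ->
    global_min (prox_model f g phi x gamma) z -> Gamma < gamma ->
    accepted f phi delta x gamma z.
Proof.
move=> [fg cg] lipg [a [b aff]] delta1.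
have [r [L [r0 L0 lip]]] := locally_lipschitz_ball xs lipg.
have fcont : {for xs, continuous f} := differentiable_continuous (fg xs).1.
have /nbhs_ballP[s /= s0 fs] : \forall y \near xs, f xs - 1 < f y.
  by apply: (cvgr_gt (f xs) fcont); rewrite ltrBlDr ltrDl.
(* half of [r], so that a step of length [rho] from the ball of radius [rho]
   ends in the ball of radius [r] *)
pose rho := Num.min (r / 2) s.
have rho0 : 0 < rho by rewrite lt_min divr_gt0.
pose A := `|M - f xs + 1 - b| + `|a| * (`|xs| + rho).
pose B := `|g xs| + L * rho + `|a|.
exists rho, (Num.max (2 * (A / rho ^+ 2 + B / rho)) (2 * L / (1 - delta))).
split=> // x z gamma xx px psiM zmin; rewrite gt_max => /andP[gam1 gam2].
have rhor : rho <= r / 2 by rewrite ge_min lexx.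
have rhos : rho <= s by rewrite ge_min lexx orbT.
have xr : ball xs r x by apply: le_ball xx; lra.
have d_xs : `|xs - x| < rho by move: xx; rewrite -ball_normE.
have fx : f xs - 1 < f x by apply: fs; exact: le_ball xx.
have A0 : 0 <= A by rewrite addr_ge0// mulr_ge0// addr_ge0// ltW.
have B0 : 0 <= B by rewrite !addr_ge0// mulr_ge0// ltW.
have gx : `|g x| <= `|g xs| + L * rho.
  have -> : g x = g xs + (g x - g xs) by rewrite subrKC.
  apply: (le_trans (ler_normD _ _)); rewrite lerD2l.
  apply: le_trans (lip _ _ xr (ballxx _ r0)) _.
  by rewrite ler_wpM2l// distrC ltW.
have nx : `|x| <= `|xs| + rho.
  have -> : x = xs + (x - xs) by rewrite subrKC.
  by apply: (le_trans (ler_normD _ _)); rewrite lerD2l distrC ltW.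
have close : `|z - x| < rho.
  apply: (prox_min_close phi_ninfty aff px zmin rho0 A0 B0 _ _ gam1).
    have : - (`|a| * `|x|) <= inner a x.
      by have := norm_inner_le a x; rewrite ler_norml => /andP[].
    have : `|a| * `|x| <= `|a| * (`|xs| + rho) by rewrite ler_wpM2l.
    have := ler_norm (M - f xs + 1 - b).
    move: psiM; rewrite /objective -(fineK px) -EFinD lee_fin /A /=.
    lra.
  by rewrite lerD2r.
apply: (prox_min_accepted phi_ninfty fg L0 lip xr _ _ px zmin).
  rewrite -ball_normE /=.
  have -> : xs - z = (xs - x) - (z - x) by rewrite opprB subrKA.
  by apply: (le_lt_trans (ler_normB _ _)); lra.
by move: gam2; rewrite ltr_pdivrMr ?subr_gt0// [gamma * _]mulrC => /ltW.
Qed.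

(** Lower semicontinuity bounds psi near xs only from below.  The bound from
    above comes from xs being a competitor in the model, whose terms other than
    phi are small when x and z are close to xs and gamma is bounded. *)
Lemma prox_min_value_upper xs Gamma e : C1_with_gradient f g ->
  phi xs \is a fin_num -> 0 <= Gamma -> 0 < e ->
  exists2 rho, 0 < rho & forall x z gamma, `|x - xs| < rho -> `|z - x| < rho ->
    0 <= gamma -> gamma <= Gamma -> phi z \is a fin_num ->
    global_min (prox_model f g phi x gamma) z ->
    f z + fine (phi z) < f xs + fine (phi xs) + e.
Proof.
move=> [fg cg] pxs Gamma0 e0.
have fcont : {for xs, continuous f} := differentiable_continuous (fg xs).1.
have /nbhs_ballP[s /= s0 fs] : \forall y \near xs, f y < f xs + e / 2.
  by apply: (cvgr_lt (f xs) fcont); rewrite ltrDl divr_gt0.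
have /nbhs_ballP[t /= t0 gt] : \forall y \near xs, `|g xs - g y| < 1.
  by move/cvgrPdist_lt: (cg xs) => /(_ 1 ltr01).
pose G := `|g xs| + 1.
have G0 : 0 < G by rewrite ltr_wpDl.
pose k := e / 2 / (2 * G + Gamma / 2).
have K0 : 0 < 2 * G + Gamma / 2 by lra.
have k0 : 0 < k by rewrite !divr_gt0.
pose rho := Num.min (Num.min (s / 2) t) (Num.min 1 k).
have rho0 : 0 < rho by rewrite !lt_min !divr_gt0//= t0 ltr01.
exists rho => // x z gamma xxs zx gamma0 gammaG pz zmin.
have [rs rt r1 rk] : [/\ rho <= s / 2, rho <= t, rho <= 1 & rho <= k].
  by split; rewrite /rho !ge_min lexx ?orbT.
have fz : f z < f xs + e / 2.
  apply: fs; rewrite -ball_normE /=.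
  have -> : xs - z = (xs - x) - (z - x) by rewrite opprB subrKA.
  by apply: (le_lt_trans (ler_normB _ _)); rewrite distrC; lra.
have gx : `|g x| < G.
  have -> : g x = g xs - (g xs - g x) by rewrite subKr.
  apply: (le_lt_trans (ler_normB _ _)); rewrite ltrD2l; apply: gt.
  by rewrite -ball_normE /= distrC; exact: lt_le_trans rt.
have bnd v : `|v| < rho -> `|inner (g x) v| <= G * rho.
  move=> vr; apply: (le_trans (norm_inner_le _ _)).
  by apply: ler_pM => //; exact: ltW.
have := prox_min_le pz pxs zmin.
have := bnd _ zx; rewrite ler_norml => /andP[b1 _].
have := bnd (xs - x); rewrite distrC ler_norml => /(_ xxs) /andP[_ b2].
have q0 : 0 <= gamma / 2 * `|z - x| ^+ 2 by rewrite !mulr_ge0// sqr_ge0.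
have q1 : gamma / 2 * `|x - xs| ^+ 2 <= Gamma / 2 * rho.
  apply: ler_pM; [by rewrite divr_ge0|by rewrite sqr_ge0|by rewrite ler_wpM2r|].
  rewrite expr2 -[leRHS]mulr1.
  by apply: ler_pM => //; [exact: ltW|exact: le_trans (ltW xxs) r1].
have q2 : (2 * G + Gamma / 2) * rho <= e / 2.
  by rewrite mulrC -ler_pdivlMr.
lra.
Qed.

End Local.

(** * Convergence from a Lyapunov recursion *)

(** Eliminating the slope c gives d1^2 <= d0 (M / sigma E); the inequality
    between the geometric and the arithmetic mean splits the product.  In the
    application c = chi'(Delta_(n+1)), D is the decrease of psi and E that of
    chi. *)
Lemma gap_recursion {R : realType} (M sigma c D E d0 d1 : R) :
  0 < sigma -> 0 <= M -> 0 <= D -> 0 <= d0 -> 0 <= d1 ->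
  1 <= c * (M * d0) -> sigma * d1 ^+ 2 <= D -> c * D <= E ->
  2 * d1 <= d0 + M / sigma * E.
Proof.
move=> sigma0 M0 D0 d00 d10 KL dec tan.
have DE : D <= M * d0 * E.
  apply: (@le_trans _ _ (c * (M * d0) * D)); first by rewrite ler_peMl.
  by rewrite mulrAC mulrC ler_wpM2l// mulr_ge0.
have d1E : d1 ^+ 2 <= d0 * (M / sigma * E).
  have -> : d0 * (M / sigma * E) = M * d0 * E / sigma by ring.
  by rewrite ler_pdivlMr// mulrC (le_trans dec).
have c0 : 0 <= c.
  rewrite leNgt; apply/negP => c0.
  have : c * (M * d0) <= 0 by rewrite nmulr_rle0// mulr_ge0.
  lra.
have E0 : 0 <= M / sigma * E.
  by rewrite mulr_ge0 ?(le_trans _ tan) ?mulr_ge0// invr_ge0 ltW.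
rewrite -(@ler_pXn2r _ 2)// ?nnegrE ?mulr_ge0 ?addr_ge0//.
move: (M / sigma * E) d1E E0 => w d1E E0.
have := sqr_ge0 (d0 - w).
nra.
Qed.

(** The recursion says that |x_(n+1) - xs| + d_n + c_(n+1) does not increase
    while the iterates stay in the ball, and a value of it below r keeps them
    there. *)
Lemma lyapunov_cvg {R : realType} {X : normedModType R} (x : nat -> X) xs
    (c : nat -> R) r N : 0 < r -> (forall n, (N <= n)%N -> 0 <= c n) ->
  (forall n, (N <= n)%N -> ball xs r (x n) -> ball xs r (x n.+1) ->
    2 * `|x n.+2 - x n.+1| + c n.+2 <= `|x n.+1 - x n| + c n.+1) ->
  (forall e, 0 < e -> exists n, [/\ (N <= n)%N, `|x n - xs| < e,
     `|x n.+1 - x n| < e & c n.+1 < e]) ->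
  x n @[n --> \oo] --> xs.
Proof.
move=> r0 c0 rec start; apply/cvgrPdist_lt => e e0.
pose e' := Num.min e r.
have e'0 : 0 < e' by rewrite lt_min e0.
(* the value at [n0] is at most |x_n0 - xs| + 2 d_n0 + c_(n0+1) *)
have [|n0 [Nn0 n01 n02 n03]] := start (e' / 4); first by rewrite divr_gt0.
pose V n := `|x n.+1 - xs| + `|x n.+1 - x n| + c n.+1.
have step n : (N <= n)%N -> ball xs r (x n) -> ball xs r (x n.+1) ->
    V n.+1 <= V n.
  move=> Nn b1 b2; have := rec n Nn b1 b2; rewrite /V.
  have : `|x n.+2 - xs| <= `|x n.+2 - x n.+1| + `|x n.+1 - xs|.
    by rewrite -[x n.+2 - xs](subrKA (x n.+1)) ler_normD.
  lra.
have V0 : V n0 < e'.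
  have : `|x n0.+1 - xs| <= `|x n0.+1 - x n0| + `|x n0 - xs|.
    by rewrite -[x n0.+1 - xs](subrKA (x n0)) ler_normD.
  rewrite /V; lra.
have inv k : ball xs e' (x (n0 + k)%N) /\ V (n0 + k)%N < e'.
  have VB n : (N <= n)%N -> V n < e' -> ball xs e' (x n.+1).
    move=> Nn; rewrite -ball_normE /= distrC; apply: le_lt_trans.
    have := c0 n.+1 (leq_trans Nn (leqnSn n)).
    have := normr_ge0 (x n.+1 - x n).
    rewrite /V; lra.
  have er : e' <= r by rewrite ge_min lexx orbT.
  elim: k => [|k [bk Vk]].
    by rewrite addn0; split=> //; rewrite -ball_normE /= distrC; lra.
  have Nk : (N <= n0 + k)%N := leq_trans Nn0 (leq_addr _ _).
  rewrite addnS; have bk1 := VB _ Nk Vk; split=> //.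
  by apply: le_lt_trans Vk; apply: step => //; exact: (le_ball er).
exists n0 => // n /= n0n.
have [+ _] := inv (n - n0)%N; rewrite subnKC// -ball_normE /=.
move=> /lt_le_trans; apply.
by rewrite ge_min lexx.
Qed.

(** * Runs of the method *)

Lemma increasing_seq_ge (nu : nat -> nat) n :
  increasing_seq nu -> (n <= nu n)%N.
Proof.
move=> incr; elim: n => // n /leq_ltn_trans; apply.
by rewrite ltnNge -leEnat incr ltnn.
Qed.

Section Run.
Context {R : realType} {X : euclideanType R}.
Context (f : X -> R) (g : X -> X) (phi : X -> \bar R).
Context (tau gmin gmax delta : R) (x : nat -> X) (gamma0 : nat -> R).
Context (trial : nat -> nat -> X) (last : nat -> nat).
Context (phi_ninfty : forall y, phi y != -oo%E).
Context (f_C1 : C1_with_gradient f g).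
Context (g_lip : locally_lipschitz g).
Context (tau_gt1 : 1 < tau) (gmin_gt0 : 0 < gmin) (delta01 : 0 < delta < 1).
Context (run : PGM_run f g phi tau gmin gmax delta x gamma0 trial last).

Let gam n := tau ^+ last n * gamma0 n.
Let val y := f y + fine (phi y).
Let d n := `|x n.+1 - x n|.

Lemma run_prox_min n : global_min (prox_model f g phi (x n) (gam n)) (x n.+1).
Proof. by rewrite (PGM_next run); exact: (PGM_trial run). Qed.

Lemma run_fin_num n : phi (x n) \is a fin_num.
Proof.
elim: n => [|n /prox_min_fin_num]; last by apply => //; exact: run_prox_min.
by rewrite fin_numE phi_ninfty lt_eqF// (PGM_start run).
Qed.

Lemma run_stepsize_ge n : gmin <= gam n.
Proof.
have /andP[+ _] := PGM_stepsize run n; rewrite /gam => g0.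
apply: (le_trans g0); rewrite ler_peMl ?exprn_ege1 ?ltW//.
exact: lt_le_trans g0.
Qed.

Lemma run_descent n : delta * gmin / 2 * d n ^+ 2 <= val (x n) - val (x n.+1).
Proof.
have := PGM_accept run n; rewrite -(PGM_next run) /accepted /objective.
rewrite -(fineK (run_fin_num n)) -(fineK (run_fin_num n.+1)) -!EFinD lee_fin.
have /andP[d0 _] := delta01.
have : delta * (gmin / 2) * d n ^+ 2 <= delta * (gam n / 2) * d n ^+ 2.
  rewrite ler_wpM2r ?sqr_ge0// ler_wpM2l ?(ltW d0)//.
  by rewrite ler_wpM2r// run_stepsize_ge.
rewrite /val -/(gam n) -/(d n); lra.
Qed.

Lemma run_nonincreasing n k : (n <= k)%N -> val (x k) <= val (x n).
Proof.
have /andP[d0 _] := delta01.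
move=> /subnKC <-; elim: (k - n)%N => [|i IH]; first by rewrite addn0.
rewrite addnS; apply: le_trans IH.
have := run_descent (n + i).
have : 0 <= delta * gmin / 2 * d (n + i) ^+ 2.
  by rewrite mulr_ge0 ?sqr_ge0// divr_ge0// mulr_ge0// ltW.
lra.
Qed.

(** Sufficient decrease bounds d_n^2 by consecutive differences of a convergent
    sequence. *)
Lemma run_gap_vanishes m : (forall n, m <= val (x n)) -> forall e, 0 < e ->
  exists N, forall n, (N <= n)%N -> d n < e.
Proof.
move=> vm e e0; have /andP[d0 _] := delta01.
have sig0 : 0 < delta * gmin / 2 by rewrite divr_gt0// mulr_gt0.
have cv : cvgn (val \o x).
  apply: nonincreasing_is_cvgn; first by move=> n k; exact: run_nonincreasing.
  by exists m => _ [n _ <-]; exact: vm.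
have /cvgrPdist_lt := cv => /(_ (delta * gmin / 2 * e ^+ 2 / 2)).
case; first by rewrite divr_gt0// mulr_gt0// exprn_gt0.
move=> N _ close; exists N => n Nn.
have := close n Nn; have := close n.+1 (leq_trans Nn (leqnSn n)).
rewrite /= !ltr_norml => /andP[_ c1] /andP[c2 _].
have := run_descent n => desc.
have : d n ^+ 2 < e ^+ 2 by rewrite -(ltr_pM2l sig0); lra.
by rewrite ltr_pXn2r// nnegrE ?normr_ge0// ltW.
Qed.

(** If step n backtracked at all, the parameter gamma_n / tau was rejected, so
    it is not large in the sense of [large_step_accepted]. *)
Lemma run_stepsize_bounded xs :
  (exists (a : X) (b : R), forall y, ((inner a y + b)%:E <= phi y)%E) ->
  exists r Gamma, [/\ 0 < r, 0 <= Gamma &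
    forall n, ball xs r (x n) -> gam n <= Gamma].
Proof.
move=> aff; have /andP[_ d1] := delta01.
have [r [G [r0 acc]]] := large_step_accepted phi_ninfty xs (val (x 0%N)) f_C1
  g_lip aff d1.
have tau0 : 0 < tau by apply: lt_trans tau_gt1.
exists r, (`|gmax| + tau * `|G|); split=> //.
  by rewrite addr_ge0// mulr_ge0// ltW.
move=> n xn; have /andP[_ g1] := PGM_stepsize run n.
have gmaxn := ler_norm gmax.
have tG : 0 <= tau * `|G| by rewrite mulr_ge0// ltW.
rewrite /gam; case E : (last n) => [|i]; first by rewrite expr0 mul1r; lra.
have [|leG] := ltP G (tau ^+ i * gamma0 n).
  have iN : (i < last n)%N by rewrite E.
  move=> Gi; case: (PGM_reject run iN).
  apply: acc Gi => //; first exact: run_fin_num.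
    rewrite /objective -(fineK (run_fin_num n)) -EFinD lee_fin.
    exact: run_nonincreasing.
  exact: (PGM_trial run (ltnW iN)).
rewrite exprS -mulrA.
have : tau * (tau ^+ i * gamma0 n) <= tau * `|G|.
  by apply: ler_wpM2l; [exact: ltW|exact: le_trans leG (ler_norm G)].
have := normr_ge0 gmax; lra.
Qed.


(** psi is lower semicontinuous at xs and nonincreasing along the run, so the
    subsequence is enough. *)
Lemma run_value_ge xs nu : lower_semicontinuous phi -> increasing_seq nu ->
  x (nu n) @[n --> \oo] --> xs -> phi xs \is a fin_num ->
  forall n, val xs <= val (x n).
Proof.
move=> lsc nu_incr cvx pxs n.
have fcont : {for xs, continuous f} := differentiable_continuous (f_C1.1 xs).1.
apply/ler_addgt0Pl => e e0.
have e20 : 0 < e / 2 by rewrite divr_gt0.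
have [|V Vxs lscV] := lsc xs (fine (phi xs) - e / 2).
  by rewrite -[X in (_ < X)%E](fineK pxs) lte_fin ltrBlDr ltrDl.
have near_xs : \forall y \near xs, V y /\ f xs - e / 2 < f y.
  near=> y; split; near: y => //.
  by apply: (cvgr_gt (f xs) fcont); rewrite ltrBlDr ltrDl.
have [N _ late] := cvx _ near_xs.
have [Vk fk] := late (maxn N n) (leq_maxl _ _).
have nk : (n <= nu (maxn N n))%N.
  by apply: leq_trans (leq_maxr N n) _; exact: increasing_seq_ge.
have := lscV _ Vk; rewrite -(fineK (run_fin_num _)) lte_fin.
have := run_nonincreasing nk; rewrite /val; lra.
Unshelve. all: by end_near. Qed.

Lemma run_visits xs nu N : increasing_seq nu ->
  x (nu n) @[n --> \oo] --> xs -> forall e, 0 < e ->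
  exists2 n, (N <= n)%N & `|x n - xs| < e.
Proof.
move=> nu_incr /cvgrPdistC_lt cvx e /cvx[M _ late].
exists (nu (maxn M N)); last exact/late/leq_maxl.
by apply: leq_trans (leq_maxr M N) _; exact: increasing_seq_ge.
Qed.

(** A single iterate close to xs followed by a short step suffices, since psi
    is nonincreasing along the run. *)
Lemma run_value_cvg xs nu e :
  (exists (a : X) (b : R), forall y, ((inner a y + b)%:E <= phi y)%E) ->
  lower_semicontinuous phi -> increasing_seq nu ->
  x (nu n) @[n --> \oo] --> xs -> phi xs \is a fin_num -> 0 < e ->
  exists N, forall n, (N <= n)%N -> val (x n) < val xs + e.
Proof.
move=> aff lsc nu_incr cvx pxs e0.
have lb := run_value_ge lsc nu_incr cvx pxs.
have [r [G [r0 G0 leG]]] := run_stepsize_bounded xs aff.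
have [rho rho0 up] := prox_min_value_upper f_C1 pxs G0 e0.
have [N small] := run_gap_vanishes lb rho0.
have [|n Nn xn] := run_visits N nu_incr cvx (e := Num.min r rho).
  by rewrite lt_min r0.
move: xn; rewrite lt_min => /andP[xr xrho].
exists n.+1 => k nk; apply: le_lt_trans (run_nonincreasing nk) _.
apply: (up (x n) _ (gam n)) => //; first exact: small.
- exact: le_trans (ltW gmin_gt0) (run_stepsize_ge n).
- by apply: leG; rewrite -ball_normE /= distrC.
- exact: run_fin_num.
- exact: run_prox_min.
Qed.

(** When the gap at x_(n+1) is zero the KL inequality is void, but then psi can
    no longer decrease and the run has stopped moving. *)
Lemma run_KL_step r L Gamma eta chi n xs : 0 <= L -> 0 <= Gamma ->
  (forall y z, ball xs r y -> ball xs r z -> `|g y - g z| <= L * `|y - z|) ->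
  ball xs r (x n) -> ball xs r (x n.+1) -> gam n <= Gamma ->
  phi xs \is a fin_num -> (forall n, val xs <= val (x n)) ->
  desingularization eta chi -> val (x n.+1) < val xs + eta ->
  ((objective f phi xs < objective f phi (x n.+1)
      < objective f phi xs + eta%:E)%E ->
   (1 <= (derive1 chi
            (fine (objective f phi (x n.+1) - objective f phi xs)))%:E
         * dist 0%R (limiting_subdiff (objective f phi) (x n.+1)))%E) ->
  2 * d n.+1 + (L + Gamma) / (delta * gmin / 2) * chi (val (x n.+2) - val xs) <=
  d n + (L + Gamma) / (delta * gmin / 2) * chi (val (x n.+1) - val xs).
Proof.
move=> L0 G0 lip bn bn1 gamG pxs lb dchi val_eta KL.
have /andP[d0 _] := delta01.
have sig0 : 0 < delta * gmin / 2 by rewrite divr_gt0// mulr_gt0.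
have desc := run_descent n.+1.
have lb1 := lb n.+1; have lb2 := lb n.+2.
have [val0|val_neq] := eqVneq (val (x n.+1)) (val xs).
  have sq0 : 0 <= delta * gmin / 2 * d n.+1 ^+ 2.
    by rewrite mulr_ge0 ?sqr_ge0// ltW.
  have val2 : val (x n.+2) = val xs by apply/le_anti/andP; split; lra.
  have /eqP : delta * gmin / 2 * d n.+1 ^+ 2 = 0.
    by apply/le_anti/andP; split; lra.
  rewrite mulf_eq0 gt_eqF//= sqrf_eq0 => /eqP ->.
  by rewrite val0 val2 mulr0 add0r lerDr normr_ge0.
have gap0 : 0 < val (x n.+1) - val xs.
  by rewrite subr_gt0 lt_neqAle eq_sym val_neq lb1.
have objE y : phi y \is a fin_num -> objective f phi y = (val y)%:E.
  by move=> py; rewrite /objective -(fineK py).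
move: KL; rewrite !objE ?run_fin_num// -EFinD !lte_fin -EFinB /= val_eta.
rewrite -subr_gt0 gap0 => /(_ isT) KL.
have sub := regular_limiting_subdiff (prox_min_regular_subdiff phi_ninfty
  f_C1.1 L0 lip bn1 (run_fin_num n.+1) (run_prox_min n)).
set c := derive1 chi _ in KL.
have c0 : 0 < c.
  by apply: (desing_derive_gt0 dchi); rewrite in_itv /= gap0 ltrBlDl.
have KLr : 1 <= c * ((L + Gamma) * d n).
  rewrite -lee_fin; apply: le_trans KL _.
  (* [dist] is at most the norm of the subgradient given by optimality *)
  rewrite EFinM lee_wpmul2l ?lee_fin ?(ltW c0)//.
  apply: (le_trans (ereal_inf_lbound _)).
    exists (g (x n.+1) - g (x n) - gam n *: (x n.+1 - x n)).
      exact: sub.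
    reflexivity.
  rewrite lee_fin subr0; apply: (le_trans (ler_normB _ _)).
  rewrite mulrDl; apply: lerD; first exact: lip.
  rewrite normrZ ger0_norm ?ler_wpM2r//.
  exact: le_trans (ltW gmin_gt0) (run_stepsize_ge n).
have tan : c * (val (x n.+1) - val (x n.+2)) <=
    chi (val (x n.+1) - val xs) - chi (val (x n.+2) - val xs).
  have -> : val (x n.+1) - val (x n.+2) =
      (val (x n.+1) - val xs) - (val (x n.+2) - val xs) by ring.
  apply: (desingularization_tangent dchi) => //; rewrite ?subr_ge0 ?ltrBlDl//.
  by rewrite lerB// run_nonincreasing.
have D0 : 0 <= val (x n.+1) - val (x n.+2).
  by rewrite subr_ge0 run_nonincreasing.
have rec := gap_recursion sig0 (addr_ge0 L0 G0) D0
  (normr_ge0 _ : 0 <= d n) (normr_ge0 _ : 0 <= d n.+1) KLr desc tan.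
set K := _ / _ in rec *; lra.
Qed.


Lemma run_cvg xs nu :
  (exists (a : X) (b : R), forall y, ((inner a y + b)%:E <= phi y)%E) ->
  lower_semicontinuous phi -> increasing_seq nu ->
  x (nu n) @[n --> \oo] --> xs -> KL_property (objective f phi) xs ->
  x n @[n --> \oo] --> xs.
Proof.
move=> aff lsc nu_incr cvx [[? [xs_dom _]] [eta [chi [eta0 dchi KL]]]].
have pxs : phi xs \is a fin_num.
  move: xs_dom; rewrite /dom /= /objective fin_numE phi_ninfty /=.
  by case: (phi xs).
have lb := run_value_ge lsc nu_incr cvx pxs.
have [r1 [L [r10 L0 lip]]] := locally_lipschitz_ball xs g_lip.
have [r2 [G [r20 G0 leG]]] := run_stepsize_bounded xs aff.
have /nbhs_ballP[r3 /= r30 KLball] := KL.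
have [N lateN] := run_value_cvg aff lsc nu_incr cvx pxs eta0.
pose K := (L + G) / (delta * gmin / 2).
have K0 : 0 <= K.
  have /andP[d0 _] := delta01.
  by rewrite divr_ge0 ?addr_ge0// divr_ge0// mulr_ge0// ltW.
pose r := Num.min r1 (Num.min r2 r3).
have [rr1 rr2 rr3] : [/\ r <= r1, r <= r2 & r <= r3].
  by split; rewrite /r !ge_min lexx ?orbT.
apply: (@lyapunov_cvg _ _ x xs (fun n => K * chi (val (x n) - val xs)) r N).
- by rewrite !lt_min r10 r20.
- move=> n Nn; rewrite mulr_ge0// (desing_ge0 dchi)// in_itv /= subr_ge0 lb /=.
  by rewrite lerBlDl ltW// lateN.
- move=> n Nn bn bn1; apply: (@run_KL_step r L G eta) => //.
  + by move=> y z /(le_ball rr1) by_ /(le_ball rr1); exact: lip.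
  + exact/leG/(le_ball rr2).
  + by apply: lateN; rewrite (leq_trans Nn).
  + exact/KLball/(le_ball rr3).
- move=> e e0.
  have K10 : 0 < K + 1 by rewrite ltr_wpDl.
  have [|s s0 small] := desingularization_small eta0 dchi (e := e / (K + 1)).
    by rewrite divr_gt0.
  have [N2 lateN2] := run_value_cvg aff lsc nu_incr cvx pxs s0.
  have [N3 lateN3] := run_gap_vanishes lb e0.
  have [n nN xn] := run_visits (maxn N (maxn N2 N3)) nu_incr cvx e0.
  move: nN; rewrite !geq_max => /and3P[Nn N2n N3n].
  exists n; split=> //; first exact: lateN3.
  have : chi (val (x n.+1) - val xs) < e / (K + 1).
    apply: small; first by rewrite subr_ge0 lb.
    by rewrite ltrBlDl lateN2// (leq_trans N2n).
  rewrite ltr_pdivlMr// mulrDr mulr1.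
  have : 0 <= chi (val (x n.+1) - val xs).
    rewrite (desing_ge0 dchi)// in_itv /= subr_ge0 lb /= lerBlDl ltW// lateN//.
    exact: leq_trans Nn _.
  nra.
Qed.

End Run.

Theorem theorem4p5 (R : realType) (X : euclideanType R)
    (f : X -> R) (gradf : X -> X) (phi : X -> \bar R)
    (tau gmin gmax delta : R) (x : nat -> X)
    (nu : nat -> nat) (xs : X)
    (f_C1 : C1_with_gradient f gradf)
    (phi_ninfty : forall y, phi y != -oo%E)
    (phi_lsc : lower_semicontinuous phi)
    (phi_proper : dom phi !=set0)
    (psi_bounded : exists m : R,
       forall y, dom phi y -> (m%:E <= objective f phi y)%E)
    (phi_affine : exists (a : X) (b : R),
       forall y, ((inner a y + b)%:E <= phi y)%E)
    (gradf_lip : locally_lipschitz gradf)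
    (tau_gt1 : 1 < tau)
    (gmin_gt0 : 0 < gmin)
    (gmin_le_gmax : gmin <= gmax)
    (delta_01 : 0 < delta < 1)
    (x_PGM : PGM_sequence f gradf phi tau gmin gmax delta x)
    (nu_incr : increasing_seq nu)
    (x_sub_cvg : x (nu n) @[n --> \oo] --> xs)
    (psi_KL : KL_property (objective f phi) xs) :
  x n @[n --> \oo] --> xs.
Proof.
have [gamma0 [trial [last run]]] := x_PGM.
exact: (run_cvg phi_ninfty f_C1 gradf_lip tau_gt1 gmin_gt0 delta_01 run
  phi_affine phi_lsc nu_incr x_sub_cvg psi_KL).
Qed.
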